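(* \textsc{PAU-VC} can be solved in linear time on split graphs: there is an algorithm that, given a split graph $G$, outputs a minimum set $S\subseteq V(G)$ such that there is exactly one minimum vertex cover of $G$ containing $S$, in time $O(|V(G)|+|E(G)|)$.
   Context: All graphs are finite and simple. A vertex cover of $G$ is a set of vertices meeting every edge. \textsc{PAU-VC}: given a graph $G$, find a minimum set $S\subseteq V(G)$ such that there is exactly one minimum vertex cover of $G$ containing $S$. A split graph is a graph whose vertex set can be partitioned into a clique and an independent set. *)

(* Defs.v *)
From mathcomp Require Import all_boot.

Set Implicit Arguments.
Unset Strict Implicit.
Unset Printing Implicit Defensive.

Record sgraph (V : finType) := SGraph {
  adj :> rel V;
  adj_sym : symmetric adj;
  adj_irrefl : irreflexive adj
}.

Section Graphs.
Variables (V : finType) (G : sgraph V).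
Implicit Types A C D K S : {set V}.

Definition edges : {set {set V}} :=
  [set [set xy.1; xy.2] | xy : V * V & G xy.1 xy.2].

Definition vertex_cover C : Prop :=
  forall A, A \in edges -> C :&: A != set0.

Definition min_vertex_cover C : Prop :=
  vertex_cover C /\ forall D, vertex_cover D -> #|C| <= #|D|.

Definition pau_feasible S : Prop :=
  exists! C, min_vertex_cover C /\ S \subset C.

Definition pau_vc_solution S : Prop :=
  pau_feasible S /\ forall S', pau_feasible S' -> #|S| <= #|S'|.

Definition clique K : Prop := {in K &, forall x y, x != y -> G x y}.

Definition independent A : Prop := {in A &, forall x y, ~~ G x y}.

Definition split_graph : Prop := exists K, clique K /\ independent (~: K).

End Graphs.

(* The random access machine of Cook and Reckhow, over the natural numbers:
   infinitely many registers, a read-only input tape, a write-only output tape,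
   addition and (truncated) subtraction as the only arithmetic, and unit cost
   for every instruction. *)
Inductive instr :=
| IConst of nat & nat          (* X_i <- a *)
| IAdd of nat & nat & nat      (* X_i <- X_j + X_k *)
| ISub of nat & nat & nat      (* X_i <- X_j - X_k *)
| ILoad of nat & nat           (* X_i <- X_(X_j) *)
| IStore of nat & nat          (* X_(X_i) <- X_j *)
| IJump of nat & nat           (* go to instruction l if X_j > 0 *)
| IRead of nat                 (* X_i <- next input symbol *)
| IPrint of nat.               (* append X_i to the output *)

Definition program := seq instr.

Record config := Config {
  pc : nat;
  reg : nat -> nat;
  input : seq nat;
  output : seq nat
}.

Definition upd (r : nat -> nat) (i a : nat) : nat -> nat :=
  fun j => if j == i then a else r j.

Definition exec_instr (ins : instr) (s : config) : option config :=
  let: Config l r x y := s in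
  match ins with
  | IConst i a => Some (Config l.+1 (upd r i a) x y)
  | IAdd i j k => Some (Config l.+1 (upd r i (r j + r k)) x y)
  | ISub i j k => Some (Config l.+1 (upd r i (r j - r k)) x y)
  | ILoad i j => Some (Config l.+1 (upd r i (r (r j))) x y)
  | IStore i j => Some (Config l.+1 (upd r (r i) (r j)) x y)
  | IJump l' j => Some (Config (if 0 < r j then l' else l.+1) r x y)
  | IRead i => if x is a :: x' then Some (Config l.+1 (upd r i a) x' y)
               else None
  | IPrint i => Some (Config l.+1 r x (rcons y (r i)))
  end.

(* There is no successor configuration once control has left the program
   (regular termination) or when reading past the end of the input (a crash,
   which does not count as termination). *)
Definition step (p : program) (s : config) : option config :=
  if onth p (pc s) is Some ins then exec_instr ins s else None.

Definition init_config (x : seq nat) : config := Config 0 (fun=> 0) x [::].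

Definition run (p : program) (t : nat) (x : seq nat) : option config :=
  iter t (obind (step p)) (Some (init_config x)).

Definition computes_in (p : program) (x : seq nat) (t : nat) (y : seq nat) :
    Prop :=
  exists s, [/\ run p t x = Some s, size p <= pc s & output s = y].

(* The neighbours of a vertex may be listed in any order. *)
Definition adjacency_lists n (G : sgraph 'I_n) (L : 'I_n -> seq 'I_n) : Prop :=
  forall v, uniq (L v) /\ forall w, (w \in L v) = G v w.

(* n, deg 0, neighbours of 0, deg 1, neighbours of 1, ..., deg (n-1),
   neighbours of n-1. *)
Definition encode_graph n (L : 'I_n -> seq 'I_n) : seq nat :=
  n :: flatten [seq size (L v) :: [seq val w | w <- L v] | v <- enum 'I_n].

(* The output lists each element of S once, in any order. *)
Definition encodes_set n (y : seq nat) (S : {set 'I_n}) : Prop :=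
  perm_eq y [seq val v | v <- enum S].

(* Main.v *)
Require Import Defs.
From mathcomp Require Import all_boot zify.

Set Implicit Arguments.
Unset Strict Implicit.
Unset Printing Implicit Defensive.

(** A split graph has a partition into a clique [K] and an independent set in
    which every vertex of [K] has a neighbour outside [K].  Its minimum vertex
    covers are then [K] and the neighbourhoods [N(v) = u + (K - v)] of the
    vertices [v] of [K] with exactly one outside neighbour [u], that is, of
    degree [#|K|].  Isolating [K] takes all these [v]; isolating [N(v)] takes
    [u] together with all other [v'] attached to [u].  So an optimal solution
    picks a [u] with the fewest (but at least one) such [v], and consists of
    [u] and all but one of them.

    The size [h] of [K] is the h-index of the degree sequence (the largest [h]
    such that [h] vertices have degree at least [h]), and any set of [h]
    vertices that contains those of degree above [h] and none of degree below
    [h] is a possible [K].  The neighbour [u] of [v] is read off the sum of the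
    neighbours of [v], so that one pass over the adjacency lists suffices. *)

(** * A structured language over the random access machine *)

Record st := St {
  var : nat -> nat;
  arr : nat -> nat -> nat;
  inp : seq nat;
  out : seq nat;
  clk : nat
}.

Definition setv (s : st) x a := St (upd (var s) x a) (arr s) (inp s) (out s) (clk s).
Definition seta (s : st) a i e :=
  St (var s) (fun b => if b == a then upd (arr s a) i e else arr s b)
     (inp s) (out s) (clk s).
Definition tick k (s : st) := St (var s) (arr s) (inp s) (out s) (clk s + k).

Inductive op :=
| Const of nat & nat
| Add of nat & nat & nat
| Sub of nat & nat & nat
| Dist of nat & nat & nat      (* x <- |y - z| *)
| Addc of nat & nat & nat
| Subc of nat & nat & nat
| Get of nat & nat & nat       (* x <- a[y] *)
| Put of nat & nat & nat       (* a[y] <- x, written Put a y x *)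
| Read of nat
| Print of nat.

(* Registers 0 and 1 are scratch; four arrays are interleaved from register 20
   on, so that addresses are computed by additions only. *)
Definition vreg x := 4 + x.
Definition areg a i := 20 + a + (i + i + (i + i)).

Definition op_code (o : op) : seq instr :=
  match o with
  | Const x a => [:: IConst (vreg x) a]
  | Add x y z => [:: IAdd (vreg x) (vreg y) (vreg z)]
  | Sub x y z => [:: ISub (vreg x) (vreg y) (vreg z)]
  | Dist x y z => [:: ISub 0 (vreg y) (vreg z); ISub 1 (vreg z) (vreg y);
                      IAdd (vreg x) 0 1]
  | Addc x y a => [:: IConst 0 a; IAdd (vreg x) (vreg y) 0]
  | Subc x y a => [:: IConst 0 a; ISub (vreg x) (vreg y) 0]
  | Get x a y => [:: IAdd 0 (vreg y) (vreg y); IAdd 0 0 0; IConst 1 (20 + a);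
                     IAdd 0 1 0; ILoad (vreg x) 0]
  | Put a y x => [:: IAdd 0 (vreg y) (vreg y); IAdd 0 0 0; IConst 1 (20 + a);
                     IAdd 0 1 0; IStore 0 (vreg x)]
  | Read x => [:: IRead (vreg x)]
  | Print x => [:: IPrint (vreg x)]
  end.

Definition op_wf (o : op) : bool :=
  match o with
  | Const x _ | Read x | Print x => x < 16
  | Add x y z | Sub x y z | Dist x y z => [&& x < 16, y < 16 & z < 16]
  | Addc x y _ | Subc x y _ => (x < 16) && (y < 16)
  | Get x a y | Put a y x => [&& x < 16, y < 16 & a < 4]
  end.

Definition op_sem (o : op) (s : st) : option st :=
  match o with
  | Const x a => Some (tick 1 (setv s x a))
  | Add x y z => Some (tick 1 (setv s x (var s y + var s z)))
  | Sub x y z => Some (tick 1 (setv s x (var s y - var s z)))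
  | Dist x y z =>
      Some (tick 3 (setv s x (var s y - var s z + (var s z - var s y))))
  | Addc x y a => Some (tick 2 (setv s x (var s y + a)))
  | Subc x y a => Some (tick 2 (setv s x (var s y - a)))
  | Get x a y => Some (tick 5 (setv s x (arr s a (var s y))))
  | Put a y x => Some (tick 5 (seta s a (var s y) (var s x)))
  | Read x => if inp s is b :: i
              then Some (St (upd (var s) x b) (arr s) i (out s) (clk s + 1))
              else None
  | Print x =>
      Some (St (var s) (arr s) (inp s) (rcons (out s) (var s x)) (clk s + 1))
  end.

Inductive cmd :=
| Skip
| Op of op
| Seq of cmd & cmd
| If of nat & cmd & cmd
| While of nat & cmd.

Coercion Op : op >-> cmd.

Fixpoint wf (c : cmd) : bool :=
  match c with
  | Skip => true
  | Op o => op_wf o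
  | Seq c1 c2 => wf c1 && wf c2
  | If x c1 c2 => [&& x < 16, wf c1 & wf c2]
  | While x c => (x < 16) && wf c
  end.

(** Jump targets are absolute, hence the address [l] of the code. The [else] branch comes first,
    being the fall-through of the test; a loop has its test at the end. Setting scratch register 0
    to 1 makes a jump unconditional. *)
Fixpoint compile (l : nat) (c : cmd) : seq instr :=
  match c with
  | Skip => [::]
  | Op o => op_code o
  | Seq c1 c2 => let p1 := compile l c1 in p1 ++ compile (l + size p1) c2
  | If x c1 c2 =>
      let p2 := compile l.+1 c2 in
      let l1 := (l + size p2).+3 in
      let p1 := compile l1 c1 in
      IJump l1 (vreg x) ::
        p2 ++ [:: IConst 0 1; IJump (l1 + size p1) 0] ++ p1
  | While x c =>
      let p := compile l.+2 c in
      [:: IConst 0 1; IJump (l.+2 + size p) 0] ++ p ++ [:: IJump l.+2 (vreg x)]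
  end.

(* The number of executed instructions is part of the state, so that the
   assertions also bound the running time. *)
Fixpoint wp (c : cmd) (Q : st -> Prop) (s : st) : Prop :=
  match c with
  | Skip => Q s
  | Op o => if op_sem o s is Some s' then Q s' else False
  | Seq c1 c2 => wp c1 (wp c2 Q) s
  | If x c1 c2 => (0 < var s x -> wp c1 Q (tick 3 s)) /\
                  (var s x = 0 -> wp c2 Q (tick 3 s))
  | While x c =>
      exists (I : st -> Prop) (m : st -> nat), I (tick 2 s) /\
        forall s, I s ->
          (0 < var s x -> wp c (fun s' => I s' /\ m s' < m s) (tick 1 s)) /\
          (var s x = 0 -> Q (tick 1 s))
  end.

Lemma wp_mono c (Q Q' : st -> Prop) s :
  (forall s, Q s -> Q' s) -> wp c Q s -> wp c Q' s.
Proof.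
elim: c Q Q' s => [|o|c1 IH1 c2 IH2|x c1 IH1 c2 IH2|x c IH] Q Q' s QQ' /=.
- exact: QQ'.
- by case: op_sem => // s'; apply: QQ'.
- by apply: IH1 => s'; apply: IH2.
- by move=> [H1 H2]; split=> [/H1|/H2]; [apply: IH1|apply: IH2].
move=> [I [m [Is H]]]; exists I, m; split=> // s' /H [H1 H2]; split=> //.
by move/H2/QQ'.
Qed.

Lemma wp_seq c1 c2 (R Q : st -> Prop) s :
  wp c1 R s -> (forall s, R s -> wp c2 Q s) -> wp (Seq c1 c2) Q s.
Proof. by move=> H1 H2 /=; apply: wp_mono H1. Qed.

(** * Correctness of the compiler *)

Definition steps (p : program) t (s s' : config) : Prop :=
  iter t (obind (step p)) (Some s) = Some s'.

Lemma steps_trans p t1 t2 s1 s2 s3 :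
  steps p t1 s1 s2 -> steps p t2 s2 s3 -> steps p (t1 + t2) s1 s3.
Proof. by rewrite /steps addnC iterD => ->. Qed.

Lemma steps_pc p t s l l' r x y :
  l = l' -> steps p t s (Config l r x y) -> steps p t s (Config l' r x y).
Proof. by move=> ->. Qed.

Definition code_at (p : program) l (q : seq instr) : Prop :=
  forall i, i < size q -> onth p (l + i) = onth q i.

Lemma onth_cat T (s1 s2 : seq T) i :
  onth (s1 ++ s2) i = if i < size s1 then onth s1 i else onth s2 (i - size s1).
Proof. by elim: s1 i => [|x s1 IH] [|i] //=; rewrite IH ltnS subSS. Qed.

Lemma code_at_cat p l q1 q2 :
  code_at p l (q1 ++ q2) -> code_at p l q1 /\ code_at p (l + size q1) q2.
Proof.
move=> H; split=> i Hi.
  by rewrite H ?onth_cat ?Hi // size_cat; lia.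
by rewrite -addnA H ?onth_cat ?size_cat ?ltn_add2l // ltnNge leq_addr addKn.
Qed.

Lemma code_at_cons p l a q :
  code_at p l (a :: q) -> onth p l = Some a /\ code_at p l.+1 q.
Proof.
move=> H; split; first by rewrite -[l]addn0 H.
by move=> i Hi; rewrite addSnnS H.
Qed.

Lemma steps_instr p ins l r x y s' :
  onth p l = Some ins -> exec_instr ins (Config l r x y) = Some s' ->
  steps p 1 (Config l r x y) s'.
Proof. by rewrite /steps /= /step /= => ->. Qed.

(** Registers 0 to 3 are left free for scratch use; the bounds 16 and 4 keep the addresses of
    variables and array cells apart. *)
Definition rep (s : st) (r : nat -> nat) : Prop :=
  (forall x, x < 16 -> r (vreg x) = var s x) /\
  (forall a i, a < 4 -> r (areg a i) = arr s a i).

Lemma rep_scratch s r j a : j < 4 -> rep s r -> rep s (upd r j a).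
Proof.
move=> Hj [H1 H2]; split=> [x Hx|b i Hb]; rewrite /upd.
  by rewrite -H1 // ifF //; apply/eqP; rewrite /vreg; lia.
by rewrite -H2 // ifF //; apply/eqP; rewrite /areg; lia.
Qed.

Lemma rep_setv s r x a :
  x < 16 -> rep s r -> rep (setv s x a) (upd r (vreg x) a).
Proof.
move=> Hx [H1 H2]; split=> [y Hy|b i Hb]; rewrite /upd /=.
  by rewrite /upd /vreg eqn_add2l -H1.
by rewrite -H2 // ifF //; apply/eqP; rewrite /areg /vreg; lia.
Qed.

Lemma rep_seta s r a i e :
  a < 4 -> rep s r -> rep (seta s a i e) (upd r (areg a i) e).
Proof.
move=> Ha [H1 H2]; split=> [y Hy|b j Hb]; rewrite /upd /=.
  by rewrite -H1 // ifF //; apply/eqP; rewrite /areg /vreg; lia.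
case: (b =P a) => [->|nba] /=.
  by rewrite /upd -H2 //; congr (if _ then _ else _); rewrite /areg; lia.
by rewrite -H2 // ifF //; apply/eqP; rewrite /areg; lia.
Qed.

Lemma rep_tick s r k : rep s r -> rep (tick k s) r.
Proof. by []. Qed.

Definition is_jump (ins : instr) := if ins is IJump _ _ then true else false.

Fixpoint exec_seq (q : seq instr) (s : config) : option config :=
  if q is a :: q' then obind (exec_seq q') (exec_instr a s) else Some s.

(** Without jumps the program counter advances by one each time, so straight-line code can be
    evaluated as a list. *)
Lemma steps_exec_seq p q l r x y s' :
  ~~ has is_jump q -> code_at p l q -> exec_seq q (Config l r x y) = Some s' ->
  steps p (size q) (Config l r x y) s'.
Proof.
elim: q l r x y => [|a q IH] l r x y; first by move=> _ _ [<-].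
rewrite [has _ _]/= negb_or => /andP[Ha Hq] /code_at_cons [Hl Hc].
rewrite [exec_seq _ _]/exec_seq -/exec_seq.
case E: (exec_instr a _) => [[l1 r1 x1 y1]|] //= Hex.
rewrite -add1n; apply: steps_trans (steps_instr Hl E) _.
suff El : l1 = l.+1 by apply: IH; rewrite // El.
case: a Ha E {Hl} => [i a|i j k|i j k|i j|i j|l' j|i|i] //=; try by move=> _ [].
by case: x => // b x' _ [].
Qed.

Lemma op_correct p o s s' l r :
  op_wf o -> op_sem o s = Some s' -> code_at p l (op_code o) -> rep s r ->
  exists t r', [/\ steps p t (Config l r (inp s) (out s))
                     (Config (l + size (op_code o)) r' (inp s') (out s')),
                   rep s' r' & clk s + t <= clk s'].
Proof.
move=> Hwf Hsem Hc Hr; have [H1 H2] := Hr.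
suff [r' E1 E2] : exists2 r',
    exec_seq (op_code o) (Config l r (inp s) (out s)) =
      Some (Config (l + size (op_code o)) r' (inp s') (out s')) & rep s' r'.
  exists (size (op_code o)), r'; split=> //.
    by apply: steps_exec_seq E1 => //; case: o {Hwf Hsem Hc}.
  case: o {Hwf Hc E1} Hsem => [x a|x y z|x y z|x y z|x y a|x y a|x a y|a y x|x|x] /=;
    try by case=> <- /=.
  by case: (inp s) => // b i [<-] /=.
case: o {Hc} Hwf Hsem => [x a|x y z|x y z|x y z|x y a|x y a|x a y|a y x|x|x] /=;
  rewrite ?addn1 ?addn2 ?addn3 ?addn4.
- by move=> Hx [<-]; eexists=> //; apply/rep_tick/rep_setv.
- move=> /and3P[Hx Hy Hz] [<-]; eexists=> //.
  by rewrite !H1 //; apply/rep_tick/rep_setv.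
- move=> /and3P[Hx Hy Hz] [<-]; eexists=> //.
  by rewrite !H1 //; apply/rep_tick/rep_setv.
- move=> /and3P[Hx Hy Hz] [<-]; eexists=> //.
  rewrite [X in upd _ _ X](_ : _ = var s y - var s z + (var s z - var s y)); last by rewrite /upd /= !H1.
  exact/rep_tick/rep_setv.
- move=> /andP[Hx Hy] [<-]; eexists=> //.
  rewrite [X in upd _ _ X](_ : _ = var s y + a); last by rewrite /upd /= !H1.
  exact/rep_tick/rep_setv.
- move=> /andP[Hx Hy] [<-]; eexists=> //.
  rewrite [X in upd _ _ X](_ : _ = var s y - a); last by rewrite /upd /= !H1.
  exact/rep_tick/rep_setv.
- move=> /and3P[Hx Hy Ha] [<-]; eexists; first by rewrite -[5]/(4.+1) addnS addn4.
  rewrite [X in upd _ (vreg x) X](_ : _ = arr s a (var s y)); last first.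
    by rewrite -H2 // -H1.
  exact/rep_tick/rep_setv.
- move=> /and3P[Hx Hy Ha] [<-]; eexists; first by rewrite -[5]/(4.+1) addnS addn4.
  by rewrite -!H1 //; apply/rep_tick/(rep_seta _ _ Ha Hr).
- by move=> Hx; case: (inp s) => // b i [<-]; eexists=> //; apply: (rep_setv _ Hx Hr).
- by move=> Hx [<-]; exists r => //=; rewrite H1.
Qed.

(** The clock only bounds the time from above: [If] charges 3 for either branch, the cost of the
    [else] branch with its two extra instructions. *)
Lemma compile_correct p c l r Q s :
  wf c -> wp c Q s -> code_at p l (compile l c) -> rep s r ->
  exists t r' s', [/\ steps p t (Config l r (inp s) (out s))
                     (Config (l + size (compile l c)) r' (inp s') (out s')),
                   rep s' r', Q s' & clk s + t <= clk s'].
Proof.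
elim: c l r Q s => [|o|c1 IH1 c2 IH2|x c1 IH1 c2 IH2|x c IH] l r Q s.
- by move=> _ H _ Hr; exists 0, r, s; rewrite /= !addn0.
- move=> /= Hwf; case E: op_sem => [s'|] // HQ Hc Hr.
  by have [t [r' [A B C]]] := op_correct Hwf E Hc Hr; exists t, r', s'.
- move=> /= /andP[Hw1 Hw2] H /code_at_cat[Hc1 Hc2] Hr.
  have [t1 [r1 [s1 [A1 B1 C1 D1]]]] := IH1 _ _ _ _ Hw1 H Hc1 Hr.
  have [t2 [r2 [s2 [A2 B2 C2 D2]]]] := IH2 _ _ _ _ Hw2 C1 Hc2 B1.
  exists (t1 + t2), r2, s2; split=> //; last by lia.
  by rewrite size_cat addnA; apply: steps_trans A1 A2.
- move=> /= /and3P[Hx Hw1 Hw2] [HT HF] /code_at_cons[Hj /code_at_cat[Hc2]].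
  rewrite -cat1s => /code_at_cons [Hl /code_at_cons [Hg Hc1]] Hr.
  set l1 := (l + _).+3 in Hj Hg Hc1 *.
  have {}Hc1 : code_at p l1 (compile l1 c1) := Hc1.
  have [Hr1 _] := Hr; case: (posnP (var s x)) => [x0|xp].
    have [t [r' [s' [A B C D]]]] := IH2 _ _ _ _ Hw2 (HF x0) Hc2 (rep_tick 3 Hr).
    exists (1 + (t + (1 + 1))), (upd r' 0 1), s'; split=> //; last by move: D => /=; lia.
    apply: steps_trans (steps_instr Hj _) _; first by rewrite /= Hr1.
    rewrite x0; apply: steps_trans A _.
    apply: steps_trans (steps_instr Hl _) _ => //.
    apply: (steps_instr Hg) => /=.
    by rewrite /upd /= size_cat /= {1}/l1; congr (Some (Config _ _ _ _)); lia.
  have [t [r' [s' [A B C D]]]] := IH1 _ _ _ _ Hw1 (HT xp) Hc1 (rep_tick 3 Hr).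
  exists (1 + t), r', s'; split=> //; last by move: D => /=; lia.
  apply: steps_trans (steps_instr Hj _) _; first by rewrite /= Hr1.
  by rewrite xp; apply: steps_pc A; rewrite size_cat /= {1}/l1; lia.
move=> /= /andP[Hx Hw] [I [m [Is H]]].
move=> /code_at_cons[Hl /code_at_cons[Hg /code_at_cat[Hc /code_at_cons[Hj _]]]] Hr.
set l1 := l.+2 + size (compile l.+2 c) in Hj Hg *.
(* A loop is entered at its test, at address [l1]. The induction is on a bound [k] for the
   measure. *)
suff loop k s1 r1 : m s1 < k -> I s1 -> rep s1 r1 ->
    exists t r' s', [/\ steps p t (Config l1 r1 (inp s1) (out s1))
                     (Config l1.+1 r' (inp s') (out s')),
                   rep s' r', Q s' & clk s1 + t <= clk s'].
  have Hr2 : rep (tick 2 s) (upd r 0 1) by apply/rep_tick/rep_scratch.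
  have [t [r' [s' [A B C D]]]] := loop _ _ _ (ltnSn _) Is Hr2.
  exists (1 + (1 + t)), r', s'; split=> //; last by move: D => /=; lia.
  apply: steps_trans (steps_instr Hl _) _ => //.
  apply: steps_trans (steps_instr Hg _) _ => //=.
  by apply: steps_pc A; rewrite size_cat /= /l1; lia.
elim: k s1 r1 => // k IHk s1 r1 Hm Is1 Hr1; have [HT HF] := H _ Is1.
have [Hv _] := Hr1; case: (posnP (var s1 x)) => [x0|xp].
  exists 1, r1, (tick 1 s1); split=> //; last exact: HF.
  by apply: (steps_instr Hj); rewrite /= Hv // x0.
have [t1 [r2 [s2 [A1 B1 [I2 M2] D1]]]] := IH _ _ _ _ Hw (HT xp) Hc (rep_tick 1 Hr1).
have [t2 [r3 [s3 [A2 B2 C2 D2]]]] := IHk _ _ (leq_trans M2 Hm) I2 B1.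
exists (1 + (t1 + t2)), r3, s3; split=> //; last by move: D1 => /=; lia.
apply: steps_trans (steps_instr Hj _) _; first by rewrite /= Hv.
by rewrite xp; apply: steps_trans A1 A2.
Qed.

Definition init_st (x : seq nat) : st :=
  St (fun=> 0) (fun _ _ => 0) x [::] 0.

Lemma wp_computes c x Q :
  wf c -> wp c Q (init_st x) ->
  exists t s, [/\ computes_in (compile 0 c) x t (out s), Q s & t <= clk s].
Proof.
move=> Hw H.
have Hc : code_at (compile 0 c) 0 (compile 0 c) by [].
have Hr : rep (init_st x) (fun=> 0) by [].
have [t [r [s [A B C D]]]] := compile_correct Hw H Hc Hr.
by exists t, s; split=> //; eexists; split; first exact: A.
Qed.

Lemma wp_op o c Q s s' :
  op_sem o s = Some s' -> wp c Q s' -> wp (Seq (Op o) c) Q s.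
Proof. by move=> /= ->. Qed.

Local Notation "c1 ;; c2" := (Seq c1 c2) (at level 90, right associativity).

(* In order: number of vertices, the two loop counters (down and up), degree,
   neighbour sum, neighbour read, h-index, counts, temporary, sum of the clique,
   vertices of degree h still to be put into the clique, best outside
   neighbour and its count. *)
Local Notation vn := 0 (only parsing).
Local Notation vi := 1 (only parsing).
Local Notation vv := 2 (only parsing).
Local Notation vd := 3 (only parsing).
Local Notation vs := 4 (only parsing).
Local Notation vw := 5 (only parsing).
Local Notation vh := 6 (only parsing).
Local Notation vc := 7 (only parsing).
Local Notation vx := 8 (only parsing).
Local Notation vk := 9 (only parsing).
Local Notation vr := 10 (only parsing).
Local Notation vb := 11 (only parsing).
Local Notation vm := 12 (only parsing).
(* Degree, neighbour sum (later the outside neighbour), number of vertices of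
   a given degree, number of vertices with a given outside neighbour. *)
Local Notation aD := 0 (only parsing).
Local Notation aX := 1 (only parsing).
Local Notation aN := 2 (only parsing).
Local Notation aU := 3 (only parsing).

(** Tests only detect positivity, so [vi] counts down to stop the loop while [vv] counts up as the
    current vertex. *)
Definition for_loop (body : cmd) : cmd :=
  Addc vi vn 0 ;; Const vv 0 ;;
  While vi (body ;; Addc vv vv 1 ;; Subc vi vi 1).

(** The ticks are the loop overhead: 5 for the initialisation and the jump to the test, 1 per test,
    4 for updating both counters. *)
Lemma wp_for body n (Inv : nat -> st -> Prop) (Q : st -> Prop) s :
  var s vn = n ->
  Inv 0 (tick 5 (setv (setv s vi n) vv 0)) ->
  (forall v s, v < n -> var s vn = n -> var s vv = v -> Inv v s ->
     wp body (fun s' => [/\ var s' vn = n, var s' vv = v, var s' vi = var s vi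
       & Inv v.+1 (tick 4 (setv (setv s' vv v.+1) vi (n - v.+1)))])
       (tick 1 s)) ->
  (forall s, var s vn = n -> Inv n s -> Q (tick 1 s)) ->
  wp (for_loop body) Q s.
Proof.
move=> En I0 Istep Iend /=.
exists (fun s => exists v, [/\ v <= n, var s vn = n, var s vv = v,
                          var s vi = n - v & Inv v s]), (fun s => var s vi).
split.
  exists 0; split=> //=; rewrite /upd /= ?En ?subn0 ?addn0 //.
  by rewrite /tick /setv /= -!addnA; exact: I0.
move=> s1 [v [Hv H1 H2 H3 H4]]; split=> Hi.
  have lt_vn : v < n by move: Hi; rewrite H3 subn_gt0.
  apply: wp_mono (Istep _ _ lt_vn H1 H2 H4) => s2 [K1 K2 K3 K4].
  split; last by rewrite /= /upd /= K3; lia.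
  exists v.+1; split=> //=; rewrite /upd /= ?K2 ?addn1 //.
    by rewrite K3 H3; lia.
  move: K4; rewrite /tick /setv /= K3 H3 -!addnA.
  by rewrite (_ : n - v.+1 = n - v - 1) //; lia.
apply: Iend => //; suff <- : v = n by [].
by move: Hi; rewrite H3; lia.
Qed.

(** * The algorithm *)

(** The inner loop uses up [vd] as its counter, so the degree is stored and tallied beforehand. *)
Definition read_phase : cmd :=
  Read vn ;;
  for_loop
    (Read vd ;; Put aD vv vd ;;
     Get vx aN vd ;; Addc vx vx 1 ;; Put aN vd vx ;;
     Const vs 0 ;;
     While vd (Read vw ;; Add vs vs vw ;; Subc vd vd 1) ;;
     Put aX vv vs).

(** [vh] descends from [n], with [vc] the number of vertices of degree at least [vh], until
    [vh <= vc]. Then [vr] is the number of vertices of degree [vh] needed to complete the clique. *)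
Definition hindex_phase : cmd :=
  Addc vh vn 0 ;; Const vc 0 ;; Sub vx vh vc ;;
  While vx (Subc vh vh 1 ;; Get vx aN vh ;; Add vc vc vx ;; Sub vx vh vc) ;;
  Get vx aN vh ;; Sub vx vc vx ;; Sub vr vh vx.

(** Vertices of degree [h] left out of the clique have their stored degree raised to [h + 1]. From
    then on, a stored degree equal to [h] identifies the clique vertices with a single outside
    neighbour. *)
Definition clique_phase : cmd :=
  Const vk 0 ;;
  for_loop
    (Get vd aD vv ;; Sub vx vd vh ;;
     If vx (Add vk vk vv)
       (Sub vx vh vd ;;
        If vx Skip
          (If vr (Subc vr vr 1 ;; Add vk vk vv)
                 (Addc vx vh 1 ;; Put aD vv vx)))).

Definition count_phase : cmd :=
  for_loop
    (Get vd aD vv ;; Dist vx vd vh ;;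
     If vx Skip
       (Get vs aX vv ;; Add vs vs vv ;; Sub vs vs vk ;; Put aX vv vs ;;
        Get vx aU vs ;; Addc vx vx 1 ;; Put aU vs vx)).

(** The initial value [n + 1] of [vm] exceeds every count and acts as infinity. *)
Definition min_phase : cmd :=
  Addc vm vn 1 ;;
  for_loop
    (Get vc aU vv ;; Sub vx vm vc ;;
     If vc (If vx (Addc vm vc 0 ;; Addc vb vv 0) Skip) Skip).

(** The first test asks whether [vm] is finite. Decrementing [vm] before the loop leaves one vertex
    attached to [vb] unprinted. *)
Definition print_phase : cmd :=
  Addc vx vn 1 ;; Sub vx vx vm ;;
  If vx
    (Print vb ;; Subc vm vm 1 ;;
     for_loop
       (Get vd aD vv ;; Dist vx vd vh ;;
        If vx Skip
          (Get vs aX vv ;; Dist vx vs vb ;;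
           If vx Skip (If vm (Print vv ;; Subc vm vm 1) Skip))))
    Skip.

Definition pau_vc_cmd : cmd :=
  read_phase ;; hindex_phase ;; clique_phase ;; count_phase ;; min_phase ;;
  print_phase.

(** * Counting on initial segments *)

Definition cnt (P : pred nat) v := count P (iota 0 v).
Arguments cnt : simpl never.

Lemma cntS P v : cnt P v.+1 = cnt P v + P v.
Proof. by rewrite /cnt -addn1 iotaD count_cat /= addn0. Qed.

Lemma cnt_ge_split (D : nat -> nat) k v :
  cnt (fun j => k <= D j) v = cnt (fun j => k < D j) v + cnt (fun j => D j == k) v.
Proof. by elim: v => // v IH; rewrite !cntS IH; case: ltngtP; lia. Qed.

Lemma cnt_card n (P : pred nat) : cnt P n = #|[set v : 'I_n | P v]|.
Proof.
rewrite /cnt -val_enum_ord count_map cardE [enum [set _ | _]]/enum_mem -enumT size_filter.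
by apply: eq_count => v /=; rewrite inE.
Qed.

(** [cnt P j] is the rank of [j] among the numbers satisfying [P], so the first [r] of them are
    kept. This is how [low] fills the clique. *)
Lemma cnt_first (P : pred nat) r v :
  cnt (fun j => P j && (cnt P j < r)) v = minn r (cnt P v).
Proof.
elim: v => [|v IH]; first by rewrite /cnt minn0.
by rewrite !cntS IH; case: (P v) => /=; case: ltnP; lia.
Qed.

(** * Invariants and running time of the phases *)

Section Correctness.
Variable ls : seq (seq nat).
Let n := size ls.
Let D j := size (nth [::] ls j).
Let X j := sumn (nth [::] ls j).
Hypothesis D_lt : forall j, j < n -> D j < n.
Let stream v := flatten [seq size l :: l | l <- drop v ls].
Let T := 40 * (size (stream 0)).+1.

Definition read_spec (s : st) : Prop :=
  [/\ var s vn = n,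
      forall j, j < n -> arr s aD j = D j /\ arr s aX j = X j,
      forall d, arr s aN d = cnt (fun j => D j == d) n,
      forall u, arr s aU u = 0 &
      out s = [::] /\ clk s <= T].

(** Each unread input symbol carries a credit of 40 instructions, which pays for both nested
    loops. *)
Lemma wp_read : wp read_phase read_spec (init_st (n :: stream 0)).
Proof.
apply: wp_op => //.
apply: (@wp_for _ n (fun v s =>
  [/\ inp s = stream v,
      forall j, j < v -> arr s aD j = D j /\ arr s aX j = X j,
      forall d, arr s aN d = cnt (fun j => D j == d) v,
      forall u, arr s aU u = 0 &
      out s = [::] /\ clk s + 40 * size (stream v) + 34 <= T])) => //.
- by split=> //=; rewrite /T; split=> //; lia.
- move=> v s lt_vn Hn Hv [Hi HD HN HU [Ho Hc]].
  have Ev : stream v = D v :: nth [::] ls v ++ stream v.+1.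
    by rewrite /stream (drop_nth [::]).
  rewrite /= Hi Ev /=.
  set L := nth [::] ls v.
  (* [L1] is the part of the list of [v] already summed, [L2] the part still on the tape. *)
  exists (fun s' => exists L1 L2, [/\ L = L1 ++ L2,
    [/\ var s' vn = n, var s' vv = v, var s' vi = var s vi,
        var s' vd = size L2 & var s' vs = sumn L1],
    inp s' = L2 ++ stream v.+1,
    [/\ forall j, arr s' aD j = (if j == v then D v else arr s aD j),
        forall j, arr s' aX j = arr s aX j,
        forall d, arr s' aN d = (if d == D v then arr s aN d + 1 else arr s aN d) &
        forall u, arr s' aU u = 0] &
    out s' = [::] /\ clk s' + 40 * size (inp s') + 45 <= T]), (fun s => var s vd).
  split.
    exists [::], L; split=> //=.
      split=> [j|j|d|u] //=; rewrite /upd /= ?Hv //.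
      by case: eqP => // ->.
    by split=> //; move: Hc; rewrite Ev /= !size_cat; lia.
  move=> s1 [L1 [L2 [EL [K1 K2 K3 K4 K5] Ki [KD KX KN KU] [Ko Kc]]]]; split=> Hd.
    case: L2 EL K4 Ki => [|w L2] EL K4 Ki; first by rewrite K4 in Hd.
    rewrite Ki /=; split; last by rewrite /upd /= K4; lia.
    exists (rcons L1 w), L2; split=> //=; first by rewrite cat_rcons.
    + rewrite /upd /=; split=> //; first by rewrite K4 /=; lia.
      by rewrite K5 sumn_rcons.
    + by split=> //; move: Kc; rewrite Ki /=; lia.
  have E2 : L2 = [::] by apply: size0nil; rewrite -K4.
  rewrite E2 /= cats0 in EL Ki; subst L1 L2.
  rewrite /upd /=; split=> //; split=> //=.
  + move=> j; rewrite ltnS leq_eqVlt K2 KD KX /upd.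
    by case: eqP => [-> _|_ /= /HD] //; rewrite K5.
  + by move=> d; rewrite KN cntS HN eq_sym; case: eqP => _; rewrite ?addn0.
  by split=> //; move: Kc; rewrite Ki; lia.
- move=> s Hn [_ HD HN HU [Ho Hc]]; split=> //; split=> //=.
  by move: Hc; lia.
Qed.


Definition is_hindex h :=
  h <= cnt (fun j => h <= D j) n /\
  forall k, h < k -> cnt (fun j => k <= D j) n < k.

Definition hindex_spec h (s : st) : Prop :=
  [/\ is_hindex h,
      [/\ var s vn = n, var s vh = h & var s vr = h - cnt (fun j => h < D j) n],
      forall j, j < n -> arr s aD j = D j /\ arr s aX j = X j,
      forall u, arr s aU u = 0 &
      out s = [::] /\ clk s <= T + 20 * n.+1].

(** Justifies starting the descent at [n] with count zero. *)
Lemma cnt_ge_n k : n <= k -> cnt (fun j => k <= D j) n = 0.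
Proof.
move=> Hk; rewrite /cnt; apply/eqP; rewrite -leqn0 leqNgt -has_count.
apply/hasPn=> j; rewrite mem_iota /= add0n => /D_lt Hj.
by rewrite -ltnNge; lia.
Qed.

Lemma wp_hindex s :
  read_spec s -> wp hindex_phase (fun s => exists h, hindex_spec h s) s.
Proof.
move=> [Hn HD HN HU [Ho Hc]] /=.
exists (fun s' => [/\
  [/\ var s' vn = n, var s' vc = cnt (fun j => var s' vh <= D j) n,
      var s' vx = var s' vh - var s' vc
    & forall k, var s' vh < k -> cnt (fun j => k <= D j) n < k],
  arr s' = arr s, out s' = [::] & clk s' + 20 * var s' vh + 12 <= T + 20 * n.+1]),
  (fun s => var s vh); split.
  rewrite /tick /setv /upd /= Hn; split=> //; last by lia.
  rewrite addn0; split=> // [|k Hk]; rewrite cnt_ge_n //; lia.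
move=> s1 [[Kn Kc Kx Kk] Ka Ko Kt]; split=> Hx.
  rewrite /upd /= Ka HN.
  (* The body runs only when [vh] exceeds [vc], so [vh] is positive and its decrement is not
     truncated. *)
  have Eh : var s1 6 = (var s1 6 - 1).+1 by lia.
  have Ek : var s1 7 + cnt (fun j => D j == var s1 6 - 1) n =
            cnt (fun j => var s1 6 - 1 <= D j) n.
    by rewrite cnt_ge_split Kc -Eh.
  rewrite /upd /=; split; last by lia.
  split=> //; last by lia.
  split=> // k Hk; have [/Kk //|] := ltnP (var s1 6) k.
  by move=> Hk'; have -> : k = var s1 6; lia.
exists (var s1 6); split=> //=; first by split=> //; lia.
- by rewrite /upd /= Ka HN Kc cnt_ge_split addnK.
- by rewrite Ka.
- by rewrite Ka.
- by split=> //; lia.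
Qed.

Section WithIndex.
Variable h : nat.
(** The places left in the clique once all vertices of degree above [h] are in it. *)
Let r := h - cnt (fun j => h < D j) n.
Definition low j := (D j == h) && (cnt (fun i => D i == h) j < r).
Definition inK j := (h < D j) || low j.
Definition sumK v := \sum_(0 <= j < v | inK j) j.
(* The only neighbour of j outside the clique K when N(j) = u + (K - j). *)
Definition priv j := X j + j - sumK n.
Definition npriv u := cnt (fun j => low j && (priv j == u)) n.

Lemma sumKS v : sumK v.+1 = sumK v + (if inK v then v else 0).
Proof. by rewrite /sumK big_mkcond big_nat_recr //= -big_mkcond. Qed.

Definition clique_spec (s : st) : Prop :=
  [/\ var s vn = n, var s vh = h /\ var s vk = sumK n,
      forall j, j < n -> (arr s aD j == h) = low j /\ arr s aX j = X j,
      forall u, arr s aU u = 0 &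
      out s = [::] /\ clk s <= T + 60 * n.+1].

Lemma wp_clique s : hindex_spec h s -> wp clique_phase clique_spec s.
Proof.
move=> [Hh [Hn Hvh Hr] HD HU [Ho Hc]].
apply: wp_op => //.
apply: (@wp_for _ n (fun v s =>
  [/\ [/\ var s vh = h, var s vr = r - cnt (fun i => D i == h) v
        & var s vk = sumK v],
      forall j, j < n -> arr s aX j = X j /\
        (if j < v then (arr s aD j == h) = low j else arr s aD j = D j),
      forall u, arr s aU u = 0 &
      out s = [::] /\ clk s + 10 <= T + 20 * n.+1 + 20 + 35 * v])) => //.
- rewrite /tick /setv /upd /=; split=> //.
  + by rewrite /sumK big_geq // subn0.
  + by move=> j /HD [].
  + by split=> //; lia.
- move=> v s1 lt_vn Kn Kv [[Kh Kr Kk] KD KU [Ko Kt]] /=.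
  have [_] := KD _ lt_vn; rewrite ltnn => EDv.
  rewrite /upd /= Kv EDv Kh Kr Kk cntS sumKS.
  split=> [Dv|/eqP Dv].
    have El : low v = false by rewrite /low; case: eqP => // E; rewrite E subnn in Dv.
    split=> //; split=> //=.
    + rewrite /inK -subn_gt0 Dv /=; split=> //.
      by case: eqP => [E|_]; [rewrite E subnn in Dv|rewrite addn0].
    + move=> j Hj; have [-> H2] := KD j Hj; split=> //; rewrite ltnS leq_eqVlt.
      case: eqP => [->|//] /=; rewrite EDv El.
      by apply/eqP => E; rewrite E subnn in Dv.
    + by split=> //; lia.
  split=> [Dv2|/eqP Dv2].
    have El : low v = false by rewrite /low; case: eqP => // E; rewrite E subnn in Dv2.
    split=> //; split=> //=.
    + rewrite /inK El -subn_gt0 (eqP Dv) /= addn0; split=> //.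
      by case: eqP => [E|_]; [rewrite E subnn in Dv2|rewrite addn0].
    + move=> j Hj; have [-> H2] := KD j Hj; split=> //; rewrite ltnS leq_eqVlt.
      case: eqP => [->|//] /=; rewrite EDv El.
      by apply/eqP => E; rewrite E subnn in Dv2.
    + by split=> //; lia.
  have Ev : D v = h by apply/eqP; rewrite eqn_leq -!subn_eq0 Dv Dv2.
  rewrite Ev eqxx.
  split=> [r0|/eqP r0].
    have El : low v by rewrite /low Ev eqxx -subn_gt0.
    split=> //; split=> //=.
    + by rewrite /inK El orbT; split=> //; lia.
    + move=> j Hj; have [-> H2] := KD j Hj; split=> //; rewrite ltnS leq_eqVlt.
      by case: eqP => [->|//] /=; rewrite EDv El Ev eqxx.
    + by split=> //; lia.
  have El : low v = false by rewrite /low Ev eqxx ltnNge -subn_eq0 r0.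
  split=> //; split=> //=.
  + by rewrite /inK El orbF Ev ltnn; split=> //; lia.
  + move=> j Hj; have [-> H2] := KD j Hj; split=> //; rewrite ltnS leq_eqVlt.
    by case: eqP => [->|//] /=; rewrite El; apply/eqP; lia.
  + by split=> //; lia.
- move=> s1 Kn [[Kh Kr Kk] KD KU [Ko Kt]]; split=> //=.
  + by move=> j Hj; have [-> ] := KD j Hj; rewrite Hj.
  + by split=> //; lia.
Qed.

Definition count_spec (s : st) : Prop :=
  [/\ var s vn = n, var s vh = h,
      forall j, j < n -> (arr s aD j == h) = low j /\ (low j -> arr s aX j = priv j),
      forall u, arr s aU u = npriv u &
      out s = [::] /\ clk s <= T + 110 * n.+1].

Lemma wp_count s : clique_spec s -> wp count_phase count_spec s.
Proof.
move=> [Hn [Hh Hk] HD HU [Ho Hc]].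
apply: (@wp_for _ n (fun v s =>
  [/\ var s vh = h /\ var s vk = sumK n,
      forall j, j < n -> (arr s aD j == h) = low j /\
        (if j < v then low j -> arr s aX j = priv j else arr s aX j = X j),
      forall u, arr s aU u = cnt (fun j => low j && (priv j == u)) v &
      out s = [::] /\ clk s + 10 <= T + 60 * n.+1 + 20 + 40 * v])) => //.
- by split=> //=; split=> //; lia.
- move=> v s1 lt_vn Kn Kv [[Kh Kk] KD KU [Ko Kt]] /=.
  have [El] := KD _ lt_vn; rewrite ltnn => EXv.
  rewrite /upd /= Kv Kh EXv Kk -/(priv v); split=> Dv.
    have lF : low v = false by rewrite -El; apply/eqP => E; rewrite E subnn in Dv.
    split=> //; split=> //=.
    + move=> j Hj; have [-> H2] := KD j Hj; split=> //; rewrite ltnS leq_eqVlt.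
      by case: eqP => [->|//] /=; rewrite lF.
    + by move=> u; rewrite cntS lF /= addn0.
    + by split=> //; lia.
  have lT : low v by rewrite -El; apply/eqP; lia.
  split=> //; split=> //=.
  + move=> j Hj; have [-> H2] := KD j Hj; split=> //; rewrite ltnS leq_eqVlt.
    by case: eqP => [->|//] /=.
  + by move=> u; rewrite cntS lT /= !KU eq_sym; case: eqP => [->|]; rewrite ?addn0.
  + by split=> //; lia.
- move=> s1 Kn [[Kh Kk] KD KU [Ko Kt]]; split=> //=.
  + by move=> j Hj; have [-> ] := KD j Hj; rewrite Hj.
  + by split=> //; lia.
Qed.

Definition min_spec (s : st) : Prop :=
  [/\ var s vn = n, var s vh = h,
      forall j, j < n -> (arr s aD j == h) = low j /\ (low j -> arr s aX j = priv j),
      (var s vm = n.+1 /\ forall u, u < n -> npriv u = 0) \/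
      [/\ var s vb < n, var s vm = npriv (var s vb), 0 < var s vm
        & forall u, u < n -> 0 < npriv u -> var s vm <= npriv u] &
      out s = [::] /\ clk s <= T + 150 * n.+1].

Lemma wp_min s : count_spec s -> wp min_phase min_spec s.
Proof.
move=> [Hn Hh HD HU [Ho Hc]].
apply: wp_op => //.
apply: (@wp_for _ n (fun v s =>
  [/\ var s vh = h /\ forall u, arr s aU u = npriv u,
      forall j, j < n -> (arr s aD j == h) = low j /\ (low j -> arr s aX j = priv j),
      (var s vm = n.+1 /\ forall u, u < v -> npriv u = 0) \/
      [/\ var s vb < n, var s vm = npriv (var s vb), 0 < var s vm
        & forall u, u < v -> 0 < npriv u -> var s vm <= npriv u] &
      out s = [::] /\ clk s + 10 <= T + 110 * n.+1 + 20 + 30 * v])) => //.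
- split=> //=; last by split=> //; lia.
  by left; rewrite /upd /= Hn addn1.
- move=> v s1 lt_vn Kn Kv [[Kh KU] KD Km [Ko Kt]] /=.
  rewrite /upd /= Kv KU; split=> Cv; last first.
    split=> //; split=> //=; last by split=> //; lia.
    case: Km => [[E1 E2]|[E1 E2 E3 E4]]; [left|right]; rewrite /upd /=.
      by split=> // u; rewrite ltnS leq_eqVlt => /orP[/eqP->|/E2].
    split=> // u; rewrite ltnS leq_eqVlt => /orP[/eqP->|/E4 //].
    by rewrite Cv.
  split=> mC.
    split=> //; split=> //=; last by split=> //; lia.
    right; rewrite /upd /= !addn0; split=> // u.
    rewrite ltnS leq_eqVlt => /orP[/eqP-> //|Hu Cu].
    case: Km => [[E1 E2]|[E1 E2 E3 E4]]; first by rewrite E2 in Cu.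
    by have := E4 _ Hu Cu; lia.
  split=> //; split=> //=; last by split=> //; lia.
  (* As counts are at most [n], failing to improve on [vm] rules out that [vm] is still infinite. *)
  have nC : npriv v <= n by rewrite /npriv /cnt (leq_trans (count_size _ _)) ?size_iota.
  case: Km => [[E1 E2]|[E1 E2 E3 E4]]; first by rewrite E1 in mC; lia.
  right; rewrite /upd /=; split=> // u.
  rewrite ltnS leq_eqVlt => /orP[/eqP-> _|/E4 //]; lia.
- by move=> s1 Kn [[Kh KU] KD Km [Ko Kt]]; split=> //=; split=> //; lia.
Qed.

Definition privs b := [seq j <- iota 0 n | low j && (priv j == b)].

(** [privs b] has [npriv b] entries, so [take] omits exactly the last one, the vertex whose
    neighbourhood is to be isolated. *)
Definition output_spec (y : seq nat) : Prop :=
  (y = [::] /\ forall u, u < n -> npriv u = 0) \/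
  exists b, [/\ b < n, 0 < npriv b,
    forall u, u < n -> 0 < npriv u -> npriv b <= npriv u
    & y = b :: take (npriv b).-1 (privs b)].

Lemma wp_print s : min_spec s ->
  wp print_phase (fun s => output_spec (out s) /\ clk s <= T + 200 * n.+1) s.
Proof.
move=> [Hn Hh HD Hm [Ho Hc]].
do 2![apply: wp_op => //].
split=> Hx; rewrite /= /upd /= Hn in Hx; last first.
  split; last by move=> /=; lia.
  left; case: Hm => [[_ H]|[E1 E2 E3 E4]] //.
  have nC : npriv (var s vb) <= n by rewrite /npriv /cnt (leq_trans (count_size _ _)) ?size_iota.
  by lia.
case: Hm => [[E _]|[E1 E2 E3 E4]]; first by lia.
set b := var s vb in E1 E2 E3 E4 *.
pose F v := [seq j <- iota 0 v | low j && (priv j == b)].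
have FS v : F v.+1 = F v ++ (if low v && (priv v == b) then [:: v] else [::]).
  by rewrite /F -addn1 iotaD filter_cat.
(* The number of vertices to print. Afterwards the truncated [k - size (F v)] stays at zero and
   blocks further printing. *)
pose k := (npriv b).-1.
do 2![apply: wp_op => //].
apply: (@wp_for _ n (fun v s =>
  [/\ [/\ var s vh = h, var s vb = b & var s vm = k - size (F v)],
      forall j, j < n -> (arr s aD j == h) = low j /\ (low j -> arr s aX j = priv j),
      out s = b :: take k (F v) &
      clk s + 10 <= T + 150 * n.+1 + 30 + 40 * v])) => //.
- split=> //=; rewrite /upd /=; last by lia.
  + by split=> //; rewrite /k -E2; lia.
  + by rewrite Ho.
- move=> v s1 lt_vn Kn Kv [[Kh Kb Km] KD Ko Kt] /=.
  have [El EX] := KD _ lt_vn.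
  rewrite /upd /= Kv Kh FS; split=> Dv.
    have lF : low v = false by rewrite -El; apply/eqP => E; rewrite E subnn in Dv.
    by rewrite lF cats0; split=> //; split=> //=; lia.
  have lT : low v by rewrite -El; apply/eqP; lia.
  rewrite lT EX // Kb; split=> Pv.
    have -> : (priv v == b) = false by apply/eqP; lia.
    by rewrite cats0; split=> //; split=> //=; lia.
  have -> : (priv v == b) by apply/eqP; lia.
  rewrite /= Km; split=> Hk.
    split=> //; split=> //=; last by lia.
    + by rewrite /upd /= size_cat /=; split=> //; lia.
    + by rewrite Ko !take_oversize ?size_cat /= ?cats1 //; lia.
  split=> //; split=> //=; last by lia.
  + by rewrite /upd /= size_cat /=; split=> //; lia.
  + by rewrite takel_cat //; lia.
- move=> s1 Kn [_ _ Ko Kt]; split; last by move: Kt => /=; lia.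
  by right; exists b; split=> //; rewrite -E2.
Qed.

End WithIndex.

Lemma wp_pau_vc :
  wp pau_vc_cmd (fun s => (exists2 h, is_hindex h & output_spec h (out s)) /\
                          clk s <= T + 200 * n.+1)
    (init_st (n :: stream 0)).
Proof.
apply: wp_seq wp_read _ => s1 /wp_hindex H1.
apply: wp_seq H1 _ => s2 [h Hs]; have [Hh _ _ _ _] := Hs.
apply: wp_seq (wp_clique Hs) _ => s3 /wp_count H3.
apply: wp_seq H3 _ => s4 /wp_min H4.
apply: wp_seq H4 _ => s5 /wp_print H5.
by apply: wp_mono H5 => s6 [H6 H7]; split=> //; exists h.
Qed.

End Correctness.

(** * Minimum vertex covers of split graphs *)

Section SplitGraph.
Variables (V : finType) (G : sgraph V).
Implicit Types (A C K S : {set V}) (u v w x y : V).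

Definition nbh v : {set V} := [set w | G v w].

Lemma in_nbh v w : (w \in nbh v) = G v w.
Proof. by rewrite inE. Qed.

Lemma vertex_coverP C :
  vertex_cover G C <-> forall x y, G x y -> x \in C \/ y \in C.
Proof.
split=> [HC x y Gxy|HC A /imsetP[[x y] /=]].
  have /HC : [set x; y] \in edges G.
    by apply/imsetP; exists (x, y); rewrite // inE.
  case/set0Pn=> z; rewrite !inE => /andP[zC /orP[]/eqP<-]; by [left|right].
rewrite inE => /= Gxy ->; apply/set0Pn.
by case: (HC x y Gxy) => H; [exists x|exists y]; rewrite !inE H eqxx ?orbT.
Qed.

(** If some [v] in [K] has no neighbour outside, move it out: it then is an outside neighbour of
    every remaining vertex of the clique, so one move suffices. *)
Lemma split_graph_dominated : split_graph G ->
  exists K, [/\ clique G K, independent G (~: K)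
              & forall v, v \in K -> exists2 w, w \notin K & G v w].
Proof.
move=> [K [cK iK]].
have [/forall_inP H|] := boolP [forall v in K, exists w, (w \notin K) && G v w].
  exists K; split=> // v /H /existsP[w /andP[wK Gvw]]; by exists w.
rewrite negb_forall => /existsP[v]; rewrite negb_imply => /andP[vK].
rewrite negb_exists => /forallP Hv.
have nGv w : w \notin K -> G v w = false.
  by move=> wK; move: (Hv w); rewrite wK /= => /negbTE.
exists (K :\ v); split.
- by move=> x y; rewrite !inE => /andP[_ xK] /andP[_ yK]; apply: cK.
- move=> x y; rewrite !inE !negb_and !negbK.
  move=> /orP[/eqP->|xK] /orP[/eqP->|yK]; rewrite ?adj_irrefl ?nGv //.
    by rewrite adj_sym nGv.
  by apply: iK; rewrite inE.
- move=> x; rewrite !inE => /andP[xv xK].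
  by exists v; [rewrite !inE eqxx|apply: cK].
Qed.

(** The outside neighbour [w] makes up for [v], which is not its own neighbour. *)
Lemma leq_card_deg K v :
  clique G K -> v \in K -> (exists2 w, w \notin K & G v w) ->
  #|K| <= #|nbh v|.
Proof.
move=> cK vK [w wK Gvw]; rewrite (cardsD1 v) vK.
have <- : #|w |: (K :\ v)| = 1 + #|K :\ v| by rewrite cardsU1 !inE (negbTE wK) andbF.
apply: subset_leq_card; apply/subsetP=> x; rewrite !inE => /orP[/eqP-> //|].
by move=> /andP[xv xK]; apply: cK => //; rewrite eq_sym.
Qed.

Lemma geq_card_deg K v : independent G (~: K) -> v \notin K -> #|nbh v| <= #|K|.
Proof.
move=> iK vK; apply: subset_leq_card; apply/subsetP=> x; rewrite inE.
by apply: contraTT => xK; apply: iK; rewrite inE.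
Qed.

(** * Degree sums and split partitions *)

(** Ordered pairs are counted, so an edge or a non-edge inside [A] counts twice. *)
Definition arcs A C := \sum_(x in A) \sum_(y in C) (G x y : nat).
Definition gaps A := \sum_(x in A) \sum_(y in A) ((x != y) && ~~ G x y : nat).

Lemma arcsC A C : arcs A C = arcs C A.
Proof.
rewrite /arcs exchange_big /=; apply: eq_bigr => x _; apply: eq_bigr => y _.
by rewrite adj_sym.
Qed.

Lemma sum_deg A : \sum_(v in A) #|nbh v| = arcs A A + arcs A (~: A).
Proof.
rewrite /arcs -big_split /=; apply: eq_bigr => v _.
rewrite -sum1_card big_mkcond (bigID (mem A)) /=; congr (_ + _).
  by apply: eq_bigr => w _; rewrite inE; case: (G v w).
by apply: eq_big => [w|w _]; rewrite inE //; case: (G v w).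
Qed.

Lemma arcs_gaps A : arcs A A + gaps A = #|A| * #|A|.-1.
Proof.
rewrite /arcs /gaps -big_split /= -sum_nat_const; apply: eq_bigr => x xA.
rewrite -big_split /= (cardsD1 x) xA /= -sum1_card [RHS]big_mkcond [LHS]big_mkcond /=.
apply: eq_bigr => y _; rewrite !inE eq_sym.
by case: eqP => [<-|_]; rewrite ?adj_irrefl; case: (_ \in A); case: (G _ _).
Qed.

Lemma gaps_eq0 A : clique G A <-> gaps A = 0.
Proof.
split=> [cA|/eqP].
  rewrite /gaps big1 // => x xA; rewrite big1 // => y yA.
  by case: (boolP (x != y)) => // xy; rewrite cA.
rewrite sum_nat_eq0 => /forall_inP H x y xA yA xy.
move: (H x xA); rewrite sum_nat_eq0 => /forall_inP/(_ y yA).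
by rewrite xy /=; case: (G x y).
Qed.

Lemma arcs_eq0 A : independent G A <-> arcs A A = 0.
Proof.
split=> [iA|/eqP].
  by rewrite /arcs big1 // => x xA; rewrite big1 // => y yA; rewrite (negbTE (iA _ _ xA yA)).
rewrite sum_nat_eq0 => /forall_inP H x y xA yA.
move: (H x xA); rewrite sum_nat_eq0 => /forall_inP/(_ y yA).
by case: (G x y).
Qed.

(* Hammer and Simeone: being a split partition is the equality case of
   [sum_K deg <= sum_(~K) deg + #|K| (#|K| - 1)], hence depends only on the
   degrees of the vertices in [K]. *)
Lemma split_partition_deg K0 K :
  clique G K0 -> independent G (~: K0) -> #|K| = #|K0| ->
  \sum_(v in K) #|nbh v| = \sum_(v in K0) #|nbh v| ->
  clique G K /\ independent G (~: K).
Proof.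
move=> /gaps_eq0 c0 /arcs_eq0 i0 Ecard Esum.
have tot A : \sum_(v in A) #|nbh v| + \sum_(v in ~: A) #|nbh v| = \sum_v #|nbh v|.
  by rewrite [RHS](bigID (mem A)) /=; congr (_ + _); apply: eq_bigl => v; rewrite inE.
have := tot K; have := tot K0; have := arcs_gaps K; have := arcs_gaps K0.
have := arcsC K (~: K); have := arcsC K0 (~: K0).
move: Esum; rewrite !sum_deg !setCK Ecard c0 i0.
move=> H1 H2 H3 H4 H5 H6 H7.
by split; [apply/gaps_eq0|apply/arcs_eq0]; lia.
Qed.

(** Outside [K] the excess over [h] truncates to zero. The right side depends on [K] only through
    its size, so all such sets of one size have the same degree sum. *)
Lemma sum_deg_threshold K h :
  (forall v, v \in K -> h <= #|nbh v|) -> (forall v, v \notin K -> #|nbh v| <= h) ->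
  \sum_(v in K) #|nbh v| = #|K| * h + \sum_v (#|nbh v| - h).
Proof.
move=> ge_h le_h; rewrite -sum_nat_const [\sum_v _](bigID (mem K)) /=.
rewrite [X in _ + (_ + X)]big1 => [|v /le_h]; last by rewrite -subn_eq0 => /eqP.
by rewrite addn0 -big_split /=; apply: eq_bigr => v /ge_h /subnKC.
Qed.

(** Group the arcs by underlying edge: at most two orientations lie over each. This bounds the input
    length by the number of edges. *)
Lemma sum_deg_edges : \sum_v #|nbh v| <= 2 * #|edges G|.
Proof.
have -> : \sum_v #|nbh v| = \sum_(xy in [set xy : V * V | G xy.1 xy.2]) 1.
  transitivity (\sum_x \sum_y (G x y : nat)).
    apply: eq_bigr => x _; rewrite -sum1_card big_mkcond.
    by apply: eq_bigr => y _; rewrite inE; case: (G x y).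
  rewrite pair_bigA [RHS]big_mkcond /=.
  by apply: eq_bigr => xy _; rewrite inE; case: (G _ _).
rewrite (partition_big_imset (fun xy => [set xy.1; xy.2])) /= mulnC.
have -> : [set [set xy.1; xy.2] | xy in [set xy : V * V | G xy.1 xy.2]] = edges G.
  by apply/setP=> A; apply/imsetP/imsetP=> -[xy];
    rewrite inE => H ->; exists xy; rewrite ?inE.
rewrite -sum_nat_const; apply: leq_sum => A /imsetP[[x y] /= _ ->].
have H : #|[set (x, y); (y, x)]| <= 2 by rewrite cards2; case: eqP.
apply: leq_trans H; rewrite sum1_card; apply/subset_leq_card/subsetP=> -[a b].
rewrite !inE /= => /andP[+ /eqP /= E]; rewrite inE /= => Gab.
have ab : a != b by apply: contraTneq Gab => ->; rewrite adj_irrefl.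
have /set2P aE : a \in [set x; y] by rewrite -E set21.
have /set2P bE : b \in [set x; y] by rewrite -E set22.
by move: ab; case: aE => ->; case: bE => ->; rewrite ?eqxx ?orbT.
Qed.

(** * Minimum covers and optimal solutions for a fixed partition *)

Section Solution.
Variable K : {set V}.
Hypotheses (cK : clique G K) (iK : independent G (~: K)).
(** Since a vertex of the clique has [#|K|.-1] neighbours in [K], this means that it has one
    outside. *)
Hypothesis deg_K : forall v, v \in K -> #|K| <= #|nbh v|.

Definition slim v := (v \in K) && (#|nbh v| == #|K|).

Lemma sub_nbh v : v \in K -> K :\ v \subset nbh v.
Proof.
move=> vK; apply/subsetP => x; rewrite !inE => /andP[xv xK].
by apply: cK => //; rewrite eq_sym.
Qed.

Lemma K_cover : vertex_cover G K.
Proof.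
apply/vertex_coverP=> x y Gxy; apply/orP; apply: contraLR Gxy.
by rewrite negb_or => /andP[xK yK]; apply: iK; rewrite inE.
Qed.

(** An edge avoiding [v] has an endpoint in [K], which is adjacent to [v]. *)
Lemma nbh_cover v : v \in K -> vertex_cover G (nbh v).
Proof.
move=> vK; apply/vertex_coverP=> x y Gxy; rewrite !in_nbh.
have [xv|/eqP xv] := x =P v; first by right; rewrite -xv.
have [yv|/eqP yv] := y =P v; first by left; rewrite -yv adj_sym.
have /vertex_coverP/(_ _ _ Gxy) := K_cover.
by case=> zK; [left|right]; apply: cK; rewrite // eq_sym.
Qed.

Lemma cover_dichotomy C : vertex_cover G C ->
  K \subset C \/ exists2 v, v \in K & nbh v \subset C.
Proof.
move/vertex_coverP=> HC; have [|/subsetPn[v vK vC]] := boolP (K \subset C).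
  by left.
right; exists v => //; apply/subsetP=> w; rewrite in_nbh => /HC[] //.
by rewrite (negbTE vC).
Qed.

Lemma cover_card C : vertex_cover G C -> #|K| <= #|C|.
Proof.
case/cover_dichotomy=> [/subset_leq_card //|[v vK /subset_leq_card]].
exact/leq_trans/deg_K.
Qed.

(** A cover that misses [v] contains [nbh v], so every cover contains [K] or some [nbh v] with [v]
    in [K]. All of these are covers of size at least [#|K|], with equality for [nbh v] exactly when
    [v] is slim. *)
Lemma min_vertex_cover_split C :
  min_vertex_cover G C <-> C = K \/ exists2 v, slim v & C = nbh v.
Proof.
split=> [[HC minC]|].
  have le_CK := minC _ K_cover.
  case/cover_dichotomy: HC => [sKC|[v vK svC]].
    by left; apply/esym/eqP; rewrite eqEcard sKC.
  right; exists v; last by apply/esym/eqP; rewrite eqEcard svC (leq_trans le_CK) ?deg_K.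
  by rewrite /slim vK eqn_leq deg_K // (leq_trans (subset_leq_card svC)).
case=> [->|[v /andP[vK /eqP Ev] ->]]; split; rewrite ?Ev.
- exact: K_cover.
- exact: cover_card.
- exact: nbh_cover.
- exact: cover_card.
Qed.

Lemma slim_nbh v : slim v -> exists2 u, u \notin K & nbh v = u |: (K :\ v).
Proof.
move=> /andP[vK /eqP Ev]; have sK := sub_nbh vK.
have /cards1P[u Eu] : #|nbh v :\: (K :\ v)| == 1.
  by rewrite cardsD (setIidPr sK) Ev (cardsD1 v) vK; lia.
have /setDP[uN uK] : u \in nbh v :\: (K :\ v) by rewrite Eu set11.
exists u; last by rewrite -Eu setUC -{1}(setID (nbh v) (K :\ v)) (setIidPr sK).
apply: contra uK => uK; rewrite !inE uK andbT.
by apply: contraTneq uN => ->; rewrite in_nbh adj_irrefl.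
Qed.

Lemma pau_vc_solution_set0 : (forall v, ~~ slim v) -> pau_vc_solution G set0.
Proof.
move=> noslim; split=> [|S _]; last by rewrite cards0.
exists K; split=> [|C [/min_vertex_cover_split [->|[v sv]] _]] //.
  by split; [apply/min_vertex_cover_split; left|apply: sub0set].
by case/negP: (noslim v).
Qed.

Variable f : V -> V.
Hypothesis f_out : forall v, slim v -> f v \notin K.
Hypothesis f_nbh : forall v, slim v -> nbh v = f v |: (K :\ v).

Definition fiber u := [set v | slim v && (f v == u)].

(** If [S] isolates [K], it contains each slim [w], as otherwise it would lie in [nbh w]. If it
    isolates [nbh v], it contains [f v], as otherwise it would lie in [K], and each other [w] in the
    fiber, as otherwise it would lie in [nbh w]; here [f v] makes up for [v]. *)
Lemma feasible_card S v0 : slim v0 -> pau_feasible G S ->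
  exists2 v, slim v & #|fiber (f v)| <= #|S|.
Proof.
move=> sv0 [C [[mC SC] uniqC]].
have minN v : slim v -> min_vertex_cover G (nbh v).
  by move=> sv; apply/min_vertex_cover_split; right; exists v.
have minK : min_vertex_cover G K by apply/min_vertex_cover_split; left.
have notin v : v \notin nbh v by rewrite in_nbh adj_irrefl.
case/min_vertex_cover_split: (mC) => [CK|[v sv Cv]].
  exists v0 => //; apply/subset_leq_card/subsetP=> w; rewrite inE => /andP[sw _].
  apply/negPn/negP=> wS; have /andP[wK _] := sw; case/negP: (notin w).
  rewrite -(uniqC (nbh w)) ?CK //; split; first exact: minN.
  apply: subset_trans (sub_nbh wK).
  by apply/subsetD1P; rewrite -CK.
exists v => //.
have fS : f v \in S.
  apply/negPn/negP=> fS; have /negP[] := f_out sv.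
  have <- : C = K; last by rewrite Cv f_nbh // setU11.
  apply: uniqC; split=> //; apply/subsetP=> x xS.
  have := subsetP SC x xS; rewrite Cv f_nbh // !inE.
  by case: eqP => [xf|_ /andP[] //]; rewrite xf (negbTE fS) in xS.
have vF : v \in fiber (f v) by rewrite inE sv eqxx.
have fF : f v \notin fiber (f v) :\ v.
  by rewrite !inE; apply: contra (f_out sv) => /and3P[_ /andP[]].
have -> : #|fiber (f v)| = #|f v |: (fiber (f v) :\ v)|.
  by rewrite cardsU1 fF (cardsD1 v) vF.
apply/subset_leq_card/subsetP=> w; rewrite !inE => /orP[/eqP-> //|].
move=> /and3P[wv sw /eqP fw]; apply/negPn/negP=> wS.
have /andP[wK _] := sw; case/negP: (notin w).
have <- : C = nbh w; last by rewrite Cv f_nbh // !inE wv wK orbT.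
apply: uniqC; split; first exact: minN.
apply/subsetP=> x xS; have := subsetP SC x xS.
rewrite Cv !f_nbh // fw !inE => /orP[-> //|/andP[_ ->]].
by rewrite andbT orbC; case: eqP => // xw; rewrite -xw xS in wS.
Qed.

(** Containing [f v0] excludes [K] and every [nbh w] with [f w] different from [f v0]; each
    remaining [nbh w] is excluded by [w] itself. The set has the size of the fiber, so
    [feasible_card] gives optimality. *)
Lemma pau_vc_solution_fiber v0 :
  slim v0 -> (forall v, slim v -> #|fiber (f v0)| <= #|fiber (f v)|) ->
  pau_vc_solution G (f v0 |: (fiber (f v0) :\ v0)).
Proof.
move=> sv0 min0.
have vF : v0 \in fiber (f v0) by rewrite inE sv0 eqxx.
have fF : f v0 \notin fiber (f v0) :\ v0.
  by rewrite !inE; apply: contra (f_out sv0) => /and3P[_ /andP[]].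
split=> [|S /(feasible_card sv0)[v /min0 H1 H2]]; last first.
  by rewrite cardsU1 fF; apply: leq_trans H2; rewrite (cardsD1 v0) vF in H1.
exists (nbh v0); split.
  split; first by apply/min_vertex_cover_split; right; exists v0.
  rewrite f_nbh // setUS //; apply/subsetP=> w; rewrite !inE.
  by move=> /and3P[-> /andP[-> _] _].
move=> C [/min_vertex_cover_split[->|[w sw ->]]] /subsetP sub.
  by have := sub (f v0) (setU11 _ _); rewrite (negbTE (f_out sv0)).
have fw : f w = f v0.
  have := sub (f v0) (setU11 _ _); rewrite f_nbh // !inE.
  by rewrite (negbTE (f_out sv0)) andbF orbF => /eqP.
have [-> //|/eqP wv] := w =P v0.
have /sub : w \in f v0 |: (fiber (f v0) :\ v0) by rewrite !inE wv sw fw eqxx orbT.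
by rewrite in_nbh adj_irrefl.
Qed.

End Solution.
End SplitGraph.

(** * Correctness of the algorithm *)

Section Bridge.
Variables (n : nat) (G : sgraph 'I_n) (L : 'I_n -> seq 'I_n).
Hypotheses (splitG : split_graph G) (HL : adjacency_lists G L).

Let ls := [seq [seq val w | w <- L v] | v <- enum 'I_n].

Lemma size_ls : size ls = n.
Proof. by rewrite size_map size_enum_ord. Qed.

Lemma nth_ls (v : 'I_n) : nth [::] ls v = [seq val w | w <- L v].
Proof. by rewrite (nth_map v) ?size_enum_ord // nth_ord_enum. Qed.

Lemma L_nbh (v : 'I_n) : L v =i nbh G v.
Proof. by move=> w; rewrite (HL v).2 inE. Qed.

Lemma deg_ls (v : 'I_n) : size (nth [::] ls v) = #|nbh G v|.
Proof. by rewrite nth_ls size_map -(card_uniqP (HL v).1); apply/eq_card/L_nbh. Qed.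

Lemma sum_ls (v : 'I_n) : sumn (nth [::] ls v) = \sum_(w in nbh G v) val w.
Proof.
rewrite nth_ls sumnE big_map big_uniq ?(HL v).1 //=; apply: eq_bigl; exact: L_nbh.
Qed.

Lemma deg_lt j : j < size ls -> size (nth [::] ls j) < size ls.
Proof.
rewrite size_ls => lt_jn; rewrite (deg_ls (Ordinal lt_jn)).
rewrite -[X in _ < X]card_ord; apply: proper_card; apply/properP; split.
  exact/subsetP.
by exists (Ordinal lt_jn); rewrite ?in_nbh ?adj_irrefl.
Qed.

Lemma encode_ls :
  encode_graph L = size ls :: flatten [seq size l :: l | l <- drop 0 ls].
Proof.
rewrite /encode_graph size_ls drop0; congr (_ :: flatten _).
by rewrite /ls -[RHS]map_comp; apply: eq_map => v /=; rewrite size_map.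
Qed.

Lemma size_stream :
  size (flatten [seq size l :: l | l <- drop 0 ls]) <= n + 2 * #|edges G|.
Proof.
rewrite drop0 size_flatten sumnE !big_map.
apply: leq_trans (leq_add (leqnn n) (sum_deg_edges G)).
have En : \sum_(v < n) 1 = n by rewrite sum1_card card_ord.
rewrite -enumT big_enum /= -[X in _ <= X + _]En -big_split /=.
by apply: leq_sum => v _; rewrite size_map -deg_ls nth_ls size_map add1n.
Qed.

(** * From the h-index to the clique and the output *)

Variable h : nat.
Hypothesis Hh : is_hindex ls h.

Let K := [set v : 'I_n | inK ls h v].

(** Compare [K] with a dominated partition [K0]. Both have size [h] and separate degrees at [h],
    hence have equal degree sums, and [split_partition_deg] applies. *)
Lemma clique_partition :
  [/\ #|K| = h, clique G K, independent G (~: K)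
    & forall v, v \in K -> h <= #|nbh G v|].
Proof.
have [K0 [c0 i0 d0]] := split_graph_dominated splitG.
have ge0 v : v \in K0 -> #|K0| <= #|nbh G v|.
  by move=> vK; apply: leq_card_deg (d0 v vK).
have le0 v : v \notin K0 -> #|nbh G v| <= #|K0| by apply: geq_card_deg.
have [] := Hh; rewrite size_ls => Hh1 Hh2.
have cntE (P : pred nat) : cnt (fun j => P (size (nth [::] ls j))) n =
    #|[set v | P #|nbh G v|]|.
  by rewrite cnt_card; apply: eq_card => v; rewrite !inE deg_ls.
(* All of [K0] has degree at least [#|K0|], and any vertex of larger degree lies in [K0]; so [#|K0|]
   is the h-index. *)
have Eh : h = #|K0|.
  apply/eqP; rewrite eqn_leq; apply/andP; split.
    rewrite leqNgt; apply/negP => lt.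
    suff : h <= #|K0| by rewrite leqNgt lt.
    apply: leq_trans Hh1 _; rewrite (cntE (fun d => h <= d)).
    apply/subset_leq_card/subsetP=> v; rewrite inE => Hv.
    by apply: contraLR lt => /le0; lia.
  rewrite leqNgt; apply/negP => /Hh2; rewrite (cntE (fun d => _ <= d)) ltnNge.
  case/negP; apply/subset_leq_card/subsetP=> v /ge0.
  by rewrite inE.
have lowE (v : 'I_n) : inK ls h v ->
    h <= #|nbh G v| by rewrite /inK /low deg_ls => /orP[/ltnW //|/andP[/eqP->]].
have cardK : #|K| = h.
  rewrite -cnt_card.
  have -> : cnt (inK ls h) n = cnt (fun j => h < size (nth [::] ls j)) n +
                              cnt (low ls h) n.
    elim: (n) => // m IH; rewrite !cntS IH /inK /low.
    by case: ltngtP => //=; lia.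
  (* [low] fills [minn r] of the vertices of degree [h]. At most [h] vertices have larger degree and
     at least [h] have degree at least [h], so the minimum is [r] and no subtraction truncates. *)
  rewrite [cnt (low _ _) n](cnt_first (fun j => size (nth [::] ls j) == h)) size_ls.
  have : cnt (fun j => h < size (nth [::] ls j)) n <= h.
    rewrite (cntE (fun d => h < d)) [X in _ <= X]Eh.
    apply/subset_leq_card/subsetP=> v; rewrite inE => Hv.
    by apply: contraLR Hv => /le0; lia.
  by move: Hh1; rewrite cnt_ge_split; lia.
have geK v : v \in K -> h <= #|nbh G v| by rewrite inE; apply: lowE.
have leK v : v \notin K -> #|nbh G v| <= h.
  by rewrite inE /inK deg_ls negb_or -leqNgt => /andP[].
suff [] : clique G K /\ independent G (~: K) by [].
apply: (split_partition_deg c0 i0); first by rewrite cardK.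
rewrite -Eh in ge0 le0.
by rewrite (sum_deg_threshold geK leK) (sum_deg_threshold ge0 le0) cardK Eh.
Qed.

(** The default [v] covers values that are not indices; [slim_priv] shows that slim vertices never
    reach it. *)
Let f (v : 'I_n) : 'I_n := insubd v (priv ls h v).

Lemma slim_low (v : 'I_n) : slim G K v = low ls h v.
Proof.
have [cardK _ _ _] := clique_partition.
rewrite /slim cardK inE /inK /low deg_ls.
by case: ltngtP => _ /=; rewrite ?andbT ?andbF.
Qed.

(** The members of [u |: (K :\ v)] sum to [u] plus the sum of [K] minus [v]; adding [v] before
    subtracting the sum of [K] leaves [u]. *)
Lemma slim_priv (v : 'I_n) : slim G K v ->
  [/\ val (f v) = priv ls h v, f v \notin K & nbh G v = f v |: (K :\ v)].
Proof.
move=> sv; have [cardK cK iK dK] := clique_partition.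
rewrite -cardK in dK; have /andP[vK _] := sv.
have [u uK Nv] := slim_nbh cK sv.
suff Eu : priv ls h v = u.
  have -> : f v = u by apply: val_inj; rewrite val_insubd Eu ltn_ord.
  by [].
rewrite /priv sum_ls Nv big_setU1 /=; last by rewrite in_setD1 (negbTE uK) andbF.
rewrite /sumK size_ls big_mkord.
have -> : \sum_(j < n | inK ls h j) j = \sum_(j in K) val j.
  by apply: eq_bigl => j; rewrite inE.
by rewrite [\sum_(j in K) _](big_setD1 v) //= -addnA [_ + val v]addnC addnK.
Qed.

Lemma npriv_fiber (v : 'I_n) : npriv ls h v = #|fiber G K f v|.
Proof.
rewrite /npriv size_ls cnt_card; apply: eq_card => w; rewrite !inE -slim_low.
by case sw: slim => //=; have [<- _ _] := slim_priv sw.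
Qed.

Lemma output_solution y : output_spec ls h y ->
  exists2 S, encodes_set y S & pau_vc_solution G S.
Proof.
have [cardK cK iK dK] := clique_partition; rewrite -cardK in dK.
have fo v (sv : slim G K v) : f v \notin K by have [] := slim_priv sv.
have fn v (sv : slim G K v) : nbh G v = f v |: (K :\ v) by have [] := slim_priv sv.
case=> [[-> H0]|[b [lt_bn b_gt0 minb ->]]].
  exists set0; first by rewrite /encodes_set enum_set0.
  apply: (pau_vc_solution_set0 cK iK dK) => v; apply/negP=> sv.
  have := H0 (f v); rewrite size_ls ltn_ord npriv_fiber => /(_ isT)/eqP.
  by rewrite cards_eq0 => /eqP/setP/(_ v); rewrite !inE sv eqxx.
rewrite size_ls in lt_bn minb.
have szF : size (privs ls h b) = npriv ls h b by rewrite size_filter.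
have uF : uniq (privs ls h b) by rewrite filter_uniq ?iota_uniq.
have memF j : j \in privs ls h b = [&& low ls h j, priv ls h j == b & j < n].
  by rewrite mem_filter mem_iota size_ls add0n -andbA.
(* The last entry [j0], the one not printed, becomes the vertex [v0] whose neighbourhood is
   isolated. *)
case/lastP: (privs ls h b) szF uF memF => [|F j0] szF uF memF.
  by rewrite -szF in b_gt0.
have -> : take (npriv ls h b).-1 (rcons F j0) = F.
  by rewrite -szF size_rcons -cats1 take_size_cat.
move: uF; rewrite rcons_uniq => /andP[j0F uF].
have /and3P[low0 /eqP priv0 lt0] : [&& low ls h j0, priv ls h j0 == b & j0 < n].
  by rewrite -memF mem_rcons inE eqxx.
pose v0 := Ordinal lt0.
have s0 : slim G K v0 by rewrite slim_low.
have f0 : val (f v0) = b by have [-> _ _] := slim_priv s0.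
exists (f v0 |: (fiber G K f (f v0) :\ v0)); last first.
  apply: (pau_vc_solution_fiber cK iK dK fo fn s0) => v sv.
  rewrite -!npriv_fiber f0; apply: minb => //.
  by rewrite npriv_fiber card_gt0; apply/set0Pn; exists v; rewrite inE sv eqxx.
have memE (v : 'I_n) : (val v \in F) = (v \in fiber G K f (f v0) :\ v0).
  have := memF v; rewrite mem_rcons inE ltn_ord andbT -slim_low !inE -(inj_eq val_inj) /=.
  case: eqP => [-> _|_ /= ->]; first exact/negbTE.
  case sv: slim => //=; have [<- _ _] := slim_priv sv.
  by rewrite -f0.
rewrite /encodes_set; apply: uniq_perm.
- rewrite /= uF andbT -f0 memE !inE negb_and; apply/orP; right.
  by apply: contra (fo _ s0) => /andP[/andP[]].
- by rewrite map_inj_uniq ?enum_uniq //; apply: val_inj.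
move=> j; have [lt_jn|ge_jn] := ltnP j n.
  pose v := Ordinal lt_jn; rewrite -[j]/(val v) (mem_map val_inj) mem_enum inE memE.
  by rewrite [RHS]inE -f0 !inE.
transitivity false.
  apply/negbTE; rewrite inE negb_or; apply/andP; split; first by apply/eqP; lia.
  apply/negP=> jF; have := memF j; rewrite mem_rcons inE jF orbT.
  by move=> /esym/and3P[_ _]; rewrite ltnNge ge_jn.
by apply/esym/negbTE/negP=> /mapP[v _ E]; have := ltn_ord v; rewrite /= in E; lia.
Qed.

End Bridge.

Theorem theorem8 :
  exists (p : program) (c : nat),
  forall (n : nat) (G : sgraph 'I_n) (L : 'I_n -> seq 'I_n),
    split_graph G -> adjacency_lists G L ->
    exists (t : nat) (y : seq nat) (S : {set 'I_n}),
      [/\ computes_in p (encode_graph L) t y,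
          t <= c * (n + #|edges G| + 1),
          encodes_set y S
        & pau_vc_solution G S].
Proof.
(* With [m] edges the input has at most [n + 2 * m] symbols after the first, so the clock is at most
   [40 * (n + 2 * m + 1) + 200 * (n + 1)], which is below [300 * (n + m + 1)]. *)
exists (compile 0 pau_vc_cmd), 300 => n G L splitG HL.
have H := wp_pau_vc (deg_lt HL); rewrite -encode_ls in H.
have [//|t [s [H1 [[h Hh /(output_solution splitG HL Hh)[S HS1 HS2]] H3] H4]]] :=
  wp_computes _ H.
exists t, (out s), S; split=> //; apply: leq_trans H4 _; apply: leq_trans H3 _.
by have := size_stream HL; rewrite size_ls; lia.
Qed.
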